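(* Let $W\in\mathbb{R}^{n\times n}$ be symmetric positive definite, let $T\in\mathbb{R}^{n\times n}$ be symmetric, indefinite and nonsingular, and let $A=W+\mathrm{i}T$. Let $\xi_1,\dots,\xi_n$ be the (real, nonzero) eigenvalues of $T^{-1}W$, and put $$\xi_{\max}^{-}=\min\{\xi_i:\xi_i<0\},\qquad \xi_{\max}^{+}=\max\{\xi_i:\xi_i>0\}.$$ For $\alpha>0$ such that $\alpha T+W$ is nonsingular, let $$G(T;\alpha)=(1+\mathrm{i}\alpha)\,T^{-1}W(\alpha T+W)^{-1}T.$$ Then $$\rho(G(T;\alpha))=\sqrt{1+\alpha^{2}}\,\max_{1\le i\le n}\frac{|\xi_i|}{|\alpha+\xi_i|}.$$ Suppose in addition that $\xi_{\max}^{-}\in(-1,0)$. Then: (i) If $\xi_{\max}^{+}\le 1$, then $\rho(G(T;\alpha))<1$ provided $$\alpha\in\left(\frac{-2\xi_{\max}^{-}}{1-(\xi_{\max}^{-})^{2}},+\infty\right).$$ (ii) If $\xi_{\max}^{+}>1$, then $\rho(G(T;\alpha))<1$ as long as $\xi_{\max}^{-}\xi_{\max}^{+}>-1$ and $$\alpha\in\left(\frac{-2\xi_{\max}^{-}}{1-(\xi_{\max}^{-})^{2}},\frac{2\xi_{\max}^{+}}{(\xi_{\max}^{+})^{2}-1}\right).$$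
   Context: A real symmetric matrix is indefinite if it has at least one positive and at least one negative eigenvalue. $T^{-1}W$ is similar to the symmetric matrix $W^{1/2}T^{-1}W^{1/2}$, so its eigenvalues are real and both signs occur. $\rho$ denotes the spectral radius. $G(T;\alpha)$ is the iteration matrix of the iteration $(\alpha T+W)x^{(k+1/2)}=(\alpha-\mathrm{i})Tx^{(k)}+b$, $Tx^{(k+1)}=\mathrm{i}Wx^{(k+1/2)}-\mathrm{i}b$ for $Ax=b$ (the PLHSS iteration with $V=T$). *)

(* Defs.v *)
From HB Require Import structures.
From mathcomp Require Import all_boot all_order all_algebra.
From mathcomp Require Import boolp classical_sets reals.
From mathcomp Require Export complex.

Set Implicit Arguments.
Unset Strict Implicit.
Unset Printing Implicit Defensive.

Import Order.TTheory GRing.Theory Num.Theory.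
Local Open Scope ring_scope.
Local Open Scope complex_scope.
Local Open Scope classical_set_scope.

Section Definitions.
Variables (R : realType) (n : nat).

Definition sym_posdef (W : 'M[R]_n) : Prop :=
  W \is symmetricmx /\
  forall x : 'cV[R]_n, x != 0 -> 0 < (x^T *m W *m x) 0 0.

Definition sym_indefinite (T : 'M[R]_n) : Prop :=
  T \is symmetricmx /\
  (exists2 a, eigenvalue T a & 0 < a) /\ (exists2 a, eigenvalue T a & a < 0).

(* [xi] lists all the complex eigenvalues of [M], with their algebraic
   multiplicities; in particular they are all real. *)
Definition is_real_spectrum (M : 'M[R]_n) (xi : 'I_n -> R) : Prop :=
  char_poly M = \prod_(i < n) ('X - (xi i)%:P).

(* The eigenvalues form a finite set, nonempty when 0 < n, so this supremum is a
   maximum. [eigenvalue] refers to left eigenvectors, which gives the same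
   eigenvalues as right eigenvectors. *)
Definition spectral_radius (G : 'M[R[i]]_n) : R :=
  sup [set ComplexField.Normc.normc l | l in [set l | eigenvalue G l]].

Definition plhss_matrix (W T : 'M[R]_n) (alpha : R) : 'M[R[i]]_n :=
  (1 +i* alpha) *:
    map_mx (real_complex R) (invmx T *m W *m invmx (alpha *: T + W) *m T).

(* The default value 0 of the next two is reached only if no [xi i] is negative,
   respectively positive. *)
Definition xi_max_neg (xi : 'I_n -> R) : R :=
  \big[Num.min/0]_(i < n | xi i < 0) xi i.

Definition xi_max_pos (xi : 'I_n -> R) : R :=
  \big[Num.max/0]_(i < n | 0 < xi i) xi i.

End Definitions.

(* Main.v *)
(** Over [C = R[i]] the spectral theorem, applied first to [W] and then to
    [S^-* T S^-1] where [W = S^* S], gives one invertible [P] with [W = P^* P]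
    and [T = P^* D P], [D] real diagonal. Hence [T^-1 W = P^-1 D^-1 P], and both
    signs occur in [D] because [T] has eigenvectors of both signs. Since
    [(alpha T + W)^-1 T = (alpha + T^-1 W)^-1], the same [P] diagonalizes the
    iteration matrix, with eigenvalues [(1 + i alpha) xi / (alpha + xi)].
    Squaring, such an eigenvalue has modulus less than 1 iff
    [alpha (xi^2 - 1) < 2 xi], and [2 xi / (xi^2 - 1)] decreases on [(-1, 0)]
    and on [(1, +oo)], so only the extreme [xi] matter. *)

Require Import Defs.
From mathcomp Require Import all_boot all_order all_algebra.
From mathcomp Require Import classical_sets reals lra ring.

Set Implicit Arguments.
Unset Strict Implicit.
Unset Printing Implicit Defensive.

Import Order.TTheory GRing.Theory Num.Theory.
Local Open Scope ring_scope.
Local Open Scope sesquilinear_scope.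
Local Open Scope complex_scope.

(** * Similarity, characteristic polynomials and diagonal matrices *)

Lemma char_poly_similar (F : fieldType) n (P A : 'M[F]_n) :
  P \in unitmx -> char_poly (invmx P *m A *m P) = char_poly A.
Proof.
move=> Punit; rewrite /char_poly.
(* The scalar matrix of the variable is central, so conjugation affects only [A]. *)
have -> : char_poly_mx (invmx P *m A *m P) =
    map_mx polyC (invmx P) *m char_poly_mx A *m map_mx polyC P.
  rewrite /char_poly_mx mulmxBr mulmxBl !map_mxM; congr (_ - _).
  by rewrite scalar_mxC -mulmxA -map_mxM mulVmx// map_mx1 mulmx1.
rewrite !det_mulmx mulrAC -det_mulmx -map_mxM mulVmx//.
by rewrite map_mx1 det1 mul1r.
Qed.

Lemma char_poly_diag (F : comNzRingType) n (d : 'rV[F]_n) :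
  char_poly (diag_mx d) = \prod_(i < n) ('X - (d 0 i)%:P).
Proof.
rewrite char_poly_trig; last first.
  by apply/is_trig_mxP => i j ltij; rewrite mxE -val_eqE ltn_eqF.
by apply: eq_bigr => i _; rewrite mxE eqxx mulr1n.
Qed.

Lemma root_prodXsubC (F : fieldType) n (f : 'I_n -> F) x :
  reflect (exists i, x = f i) (root (\prod_(i < n) ('X - (f i)%:P)) x).
Proof.
rewrite /root horner_prod; apply: (iffP idP) => [/prodf_eq0[i _]|[i ->]].
  by rewrite !hornerE subr_eq0 => /eqP; exists i.
by apply/prodf_eq0; exists i; rewrite // !hornerE subrr.
Qed.

Lemma mulmx_diag_inv (F : fieldType) n (d : 'rV[F]_n) :
  (forall i, d 0 i != 0) ->
  diag_mx d *m diag_mx (\row_i (d 0 i)^-1) = 1%:M.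
Proof.
move=> d0; rewrite mul_diag_mx; apply/matrixP => i j; rewrite !mxE.
by case: eqVneq => [->|_]; rewrite ?mulr0// mulr1n divff.
Qed.

(** * Simultaneous diagonalization of a Hermitian pair by congruence *)

Section HermitianPair.
Variables (C : numClosedFieldType) (n : nat).
Implicit Types (W T P : 'M[C]_n) (d : 'rV[C]_n).

Lemma trmxC_mul m p q (A : 'M[C]_(m, p)) (B : 'M[C]_(p, q)) :
  (A *m B)^t* = B^t* *m A^t*.
Proof. by rewrite trmx_mul map_mxM. Qed.

Lemma trmxC_diag_real d : d \is a mxOver Num.real -> (diag_mx d)^t* = diag_mx d.
Proof. by move=> dR; rewrite tr_diag_mx map_diag_mx realmxC. Qed.

Lemma hermsymmxP W : reflect (W^t* = W) (W \is hermsymmx).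
Proof.
apply: (iffP (is_hermitianmxP _ _ _)); rewrite expr0 scale1r => WE.
  by symmetry; rewrite [LHS]WE.
by symmetry.
Qed.

Lemma diag_form d (v : 'rV[C]_n) :
  (v *m diag_mx d *m v^t*) 0 0 = \sum_i d 0 i * `|v 0 i| ^+ 2.
Proof.
rewrite mul_mx_diag mxE; apply: eq_bigr => i _.
by rewrite !mxE mulrAC normCK mulrC.
Qed.

(** The spectral theorem gives W = U^* E U with U unitary; positivity of the form makes E positive,
    and S = E^(1/2) U is a factor. *)
Lemma posdef_sqrt W : W \is hermsymmx ->
  (forall v : 'rV[C]_n, v != 0 -> 0 < (v *m W *m v^t*) 0 0) ->
  exists2 S : 'M[C]_n, S \in unitmx & W = S^t* *m S.
Proof.
move=> Wherm Wpos; set U := spectralmx W; set e := spectral_diag W.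
have UU : U \in unitmx := spectral_unit W.
have UV : U^t* = invmx U by rewrite invmx_unitary ?spectral_unitarymx.
have WE : W = U^t* *m diag_mx e *m U.
  by rewrite UV; exact/orthomx_spectralP/hermitian_normalmx.
have e_gt0 i : 0 < e 0 i.
  (* Row [i] of [U] is a left eigenvector of [W], at which the form takes the value [e 0 i]. *)
  have := Wpos (delta_mx 0 i *m U).
  rewrite WE UV !mulmxA mulmxK// trmxC_mul UV !mulmxA mulmxK// diag_form.
  rewrite (bigD1 i)//= big1 => [|j ji]; last first.
    by rewrite mxE (negbTE ji) andbF normr0 expr0n mulr0.
  rewrite mxE !eqxx normr1 expr1n mulr1 addr0; apply.
  (* This row is nonzero: multiplied by the inverse of [U] it becomes a unit row. *)
  apply: contraTneq (oner_neq0 C) => /(congr1 (mulmx^~ (invmx U))).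
  rewrite mulmxK// mul0mx => /matrixP/(_ 0 i); rewrite !mxE !eqxx => /eqP.
  by rewrite negbK.
pose s := \row_i sqrtC (e 0 i).
have sR : s \is a mxOver Num.real.
  by apply/mxOverP => i j; rewrite mxE ger0_real// sqrtC_ge0 ltW.
exists (diag_mx s *m U); last first.
  rewrite trmxC_mul trmxC_diag_real// mulmxA -[_ *m _ *m diag_mx s]mulmxA {1}WE.
  congr (_ *m _ *m _); rewrite mul_diag_mx; apply/matrixP => i j; rewrite !mxE.
  by case: eqVneq => [->|_]; rewrite ?mulr0// mulr1n -expr2 sqrtCK.
rewrite unitmx_mul UU andbT unitmxE det_diag unitfE.
by apply/prodf_neq0 => i _; rewrite mxE sqrtC_eq0 gt_eqF.
Qed.

(** The matrix S^-* T S^-1 is Hermitian, so it equals V^* D V with V unitary. As V^* V = 1,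
    replacing S by V S keeps W = S^* S and makes T diagonal. *)
Lemma hermitian_pair_diag W T : W \is hermsymmx ->
  (forall v : 'rV[C]_n, v != 0 -> 0 < (v *m W *m v^t*) 0 0) ->
  T \is hermsymmx ->
  exists P d, [/\ P \in unitmx, d \is a mxOver Num.real,
    W = P^t* *m P & T = P^t* *m diag_mx d *m P].
Proof.
move=> Wherm Wpos Therm; have [S SU WE] := posdef_sqrt Wherm Wpos.
pose H := (invmx S)^t* *m T *m invmx S.
have Hherm : H \is hermsymmx.
  by apply/hermsymmxP; rewrite !trmxC_mul trmxCK (hermsymmxP _ Therm) mulmxA.
set V := spectralmx H; set f := spectral_diag H.
have VU : V \in unitmx := spectral_unit H.
have VV : V^t* = invmx V by rewrite invmx_unitary ?spectral_unitarymx.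
have HE : H = V^t* *m diag_mx f *m V.
  by rewrite VV; exact/orthomx_spectralP/hermitian_normalmx.
exists (V *m S), f; split.
- by rewrite unitmx_mul VU.
- exact: hermitian_spectral_diag_real.
- by rewrite trmxC_mul VV mulmxA mulmxKV.
- rewrite trmxC_mul !mulmxA -[_ *m _ *m diag_mx f]mulmxA -[_ *m _ *m V]mulmxA.
  rewrite -HE /H !mulmxA -trmxC_mul mulVmx// trmx1 map_mx1 mul1mx.
  by rewrite mulmxKV.
Qed.

(** Part of Sylvester's law of inertia: with y = x P^*, the form is the sum of d_i |y_i|^2, which
    nonnegative d_i would make nonnegative. *)
Lemma congr_diag_neg T P d (x : 'rV[C]_n) :
  d \is a mxOver Num.real -> T = P^t* *m diag_mx d *m P ->
  (x *m T *m x^t*) 0 0 < 0 -> exists i, d 0 i < 0.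
Proof.
move=> dR TE; have -> : x *m T *m x^t* =
    (x *m P^t*) *m diag_mx d *m (x *m P^t*)^t*.
  by rewrite TE trmxC_mul trmxCK !mulmxA.
rewrite diag_form => sum_lt0.
have [/existsP//|/existsPn d_ge0] := boolP [exists i, d 0 i < 0].
suff : 0 <= \sum_i d 0 i * `|(x *m P^t*) 0 i| ^+ 2.
  by rewrite lt_geF.
apply: sumr_ge0 => i _; rewrite mulr_ge0 ?exprn_ge0//.
by rewrite real_leNgt ?real0// ?d_ge0// (mxOverP dR).
Qed.

End HermitianPair.

(** * The real pencil over the complex numbers and the spectrum of the iteration matrix *)

Section RealPencil.
Variables (R : realType) (n : nat).
Implicit Types (W T M : 'M[R]_n) (P : 'M[R[i]]_n) (xi : 'I_n -> R).
Local Notation toC := (real_complex R).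

Lemma conj_real_complex (x : R) : Num.conj (toC x) = toC x.
Proof. exact: conjc_real. Qed.

Lemma conj_real_complex_mx m p (A : 'M[R]_(m, p)) :
  (map_mx toC A)^t* = map_mx toC A^T.
Proof. by apply/matrixP => i j; rewrite !mxE conj_real_complex. Qed.

Lemma symmetricmxP M : reflect (M^T = M) (M \is symmetricmx).
Proof.
by apply: (iffP (is_hermitianmxP _ _ _)); rewrite expr0 scale1r map_mx_id.
Qed.

Lemma real_symmetric_hermsym M :
  M \is symmetricmx -> map_mx toC M \is hermsymmx.
Proof.
by move=> /symmetricmxP ME; apply/hermsymmxP; rewrite conj_real_complex_mx ME.
Qed.

(** For v = x + i y the cross terms -i x M y^T and i y M x^T cancel by symmetry of [M]. *)
Lemma symmetric_form_complex M (v : 'rV[R[i]]_n)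
    (x := map_mx (@complex.Re R) v) (y := map_mx (@complex.Im R) v) :
  M \is symmetricmx ->
  (v *m map_mx toC M *m v^t*) 0 0 =
  toC ((x *m M *m x^T) 0 0 + (y *m M *m y^T) 0 0).
Proof.
move=> /symmetricmxP ME.
(* A 1 by 1 matrix is its own transpose. *)
have xMy : y *m M *m x^T = x *m M *m y^T.
  by rewrite -[LHS]trmxK [X in X^T]mx11_scalar tr_scalar_mx -mx11_scalar
    !trmx_mul trmxK ME mulmxA.
have -> : v = map_mx toC x + 'i%C *: map_mx toC y.
  by apply/matrixP => i j; rewrite !mxE [LHS]complexE.
rewrite linearD/= map_mxD conj_real_complex_mx.
have -> : ('i%C *: map_mx toC y)^t* = - 'i%C *: map_mx toC y^T.
  apply/matrixP => i j; rewrite !mxE rmorphM/= conj_real_complex.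
  by congr (_ * _); apply/eqP; rewrite eq_complex /= oppr0 !eqxx.
rewrite !(mulmxDl, mulmxDr) -!(scalemxAl, scalemxAr) -!map_mxM/= xMy.
rewrite !scaleNr addrA addrK scalerN scalerA -expr2 sqr_i scaleN1r opprK.
by rewrite rmorphD !mxE.
Qed.

Lemma row_form_gt0 (x : 'rV[R]_n) : x != 0 -> 0 < (x *m x^T) 0 0.
Proof.
move=> x0; have [i xi0] : exists i, x 0 i != 0.
  apply/existsP; apply: contraNT x0 => /existsPn x0.
  by apply/eqP/rowP => i; rewrite mxE; apply/eqP; rewrite -[_ == _]negbK x0.
rewrite mxE (bigD1 i)//= mxE -expr2 ltr_pwDl//.
  by rewrite lt_def sqrf_eq0 xi0 sqr_ge0.
by apply: sumr_ge0 => j _; rewrite mxE -expr2 sqr_ge0.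
Qed.

Lemma sym_posdef_complex W (v : 'rV[R[i]]_n) : sym_posdef W -> v != 0 ->
  0 < (v *m map_mx toC W *m v^t*) 0 0.
Proof.
move=> [Wsym Wpos] v0; rewrite symmetric_form_complex// ltcR.
have Wrow (x : 'rV[R]_n) : x != 0 -> 0 < (x *m W *m x^T) 0 0.
  by move=> x0; have := Wpos x^T; rewrite trmxK; apply; rewrite trmx_eq0.
have Wrow0 (x : 'rV[R]_n) : 0 <= (x *m W *m x^T) 0 0.
  by have [->|/Wrow/ltW//] := eqVneq x 0; rewrite !mul0mx mxE.
(* The real or the imaginary part of [v] is nonzero, so one of the two nonnegative summands is
   positive. *)
have [Re0|Re0] := eqVneq (map_mx (@complex.Re R) v) 0; last first.
  by rewrite ltr_pwDl// Wrow.
rewrite ltr_wpDl// Wrow//; apply: contra_neq v0 => Im0.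
by apply/rowP => i; move/rowP/(_ i): Re0; move/rowP/(_ i): Im0;
  rewrite !mxE; case: (v 0 i) => a b /= -> ->.
Qed.

(** A left eigenvector x gives x T x^T = a x x^T, a negative value of the form. *)
Lemma eigenvalue_congr_diag_neg T P (d : 'rV[R[i]]_n) a :
  d \is a mxOver Num.real -> map_mx toC T = P^t* *m diag_mx d *m P ->
  eigenvalue T a -> a < 0 -> exists i, d 0 i < 0.
Proof.
move=> dR TE /eigenvalueP[x xT x0] a_lt0.
apply: (@congr_diag_neg _ _ _ _ _ (map_mx toC x) dR TE).
rewrite conj_real_complex_mx -!map_mxM xT mxE -scalemxAl.
by rewrite ltcR mxE nmulr_rlt0// row_form_gt0.
Qed.

Lemma pencil_diag W T : sym_posdef W -> sym_indefinite T -> T \in unitmx ->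
  exists P xi, [/\ P \in unitmx,
    map_mx toC (invmx T *m W) =
      invmx P *m diag_mx (\row_i toC (xi i)) *m P,
    forall i, xi i != 0, exists i, xi i < 0 & exists i, 0 < xi i].
Proof.
move=> Wpd [Tsym [[a Ta a_gt0] [b Tb b_lt0]]] TU; have Wsym := Wpd.1.
have [P [d [PU dR WE TE]]] := hermitian_pair_diag (real_symmetric_hermsym Wsym)
  (fun v => sym_posdef_complex Wpd) (real_symmetric_hermsym Tsym).
have d0 i : d 0 i != 0.
  have : map_mx toC T \in unitmx by rewrite map_unitmx.
  rewrite TE !unitmx_mul PU andbT => /andP[_].
  by rewrite unitmxE unitfE det_diag => /prodf_neq0; apply.
(* The reciprocals of the real [d 0 i] are real, so taking real parts loses nothing; signs are
   preserved too. *)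
pose xi i := complex.Re (d 0 i)^-1.
have xiE i : toC (xi i) = (d 0 i)^-1.
  by apply: RRe_real; rewrite realV (mxOverP dR).
have [i di_lt0] := eigenvalue_congr_diag_neg dR TE Tb b_lt0.
have [j dj_gt0] : exists j, 0 < d 0 j.
  (* A positive entry comes from the negative case applied to [- T]. *)
  have [||||j] := @eigenvalue_congr_diag_neg (- T) P (- d) (- a).
  - by apply/mxOverP => k l; rewrite mxE realN (mxOverP dR).
  - by rewrite map_mxN TE raddfN/= mulmxN mulNmx.
  - apply/eigenvalueP; have /eigenvalueP[x xT x0] := Ta; exists x => //.
    by rewrite mulmxN xT scaleNr.
  - by rewrite oppr_lt0.
  by rewrite mxE oppr_lt0; exists j.
exists P, xi; split; first exact: PU.
- rewrite map_mxM map_invmx WE; apply: (canLR (mulKmx _)).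
    by rewrite map_unitmx.
  rewrite TE !mulmxA (mulmxK PU) -[_ *m diag_mx d *m _]mulmxA.
  have -> : \row_i toC (xi i) = \row_i (d 0 i)^-1.
    by apply/rowP => k; rewrite !mxE xiE.
  by rewrite mulmx_diag_inv// mulmx1.
- by move=> k; rewrite -(inj_eq (@complexI R)) xiE invr_eq0.
- by exists i; rewrite -ltcR xiE invr_lt0.
- by exists j; rewrite -ltcR xiE invr_gt0.
Qed.

(** Both polynomials are real and the embedding into the complex polynomials is injective, so the
    complex diagonalization suffices. *)
Lemma is_real_spectrum_diag M P xi : P \in unitmx ->
  map_mx toC M = invmx P *m diag_mx (\row_i toC (xi i)) *m P ->
  is_real_spectrum M xi.
Proof.
move=> PU ME; apply: (map_poly_inj toC).
rewrite map_char_poly ME char_poly_similar// char_poly_diag rmorph_prod.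
by apply: eq_bigr => i _; rewrite mxE rmorphB/= map_polyX map_polyC.
Qed.

(** Both lists run through the roots of one polynomial. This carries facts about the constructed
    eigenvalues over to an arbitrary list. *)
Lemma real_spectrum_mem M xi xi' : is_real_spectrum M xi ->
  is_real_spectrum M xi' -> forall i, exists j, xi i = xi' j.
Proof.
move=> Mxi Mxi' i; apply/root_prodXsubC; rewrite -Mxi' Mxi.
by apply/root_prodXsubC; exists i.
Qed.

Lemma plhss_matrix_diag W T P xi alpha : T \in unitmx -> P \in unitmx ->
  map_mx toC (invmx T *m W) = invmx P *m diag_mx (\row_i toC (xi i)) *m P ->
  alpha *: T + W \in unitmx ->
  (forall i, alpha + xi i != 0) /\
  plhss_matrix W T alpha = invmx P *m
    diag_mx (\row_i ((1 +i* alpha) * toC (xi i / (alpha + xi i)))) *m P.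
Proof.
move=> TU PU NE AU; set B := invmx (alpha *: T + W) *m T.
pose D := diag_mx (\row_i toC (alpha + xi i)).
have DE : D = (toC alpha)%:M + diag_mx (\row_i toC (xi i)).
  by apply/matrixP => i j; rewrite !mxE rmorphD mulrnDl.
have NaE : map_mx toC (alpha%:M + invmx T *m W) = invmx P *m D *m P.
  rewrite DE mulmxDr mulmxDl -NE -mulmxA -scalar_mxC (mulKmx PU).
  by rewrite map_mxD map_scalar_mx.
have NaB : (alpha%:M + invmx T *m W) *m B = 1%:M.
  have -> : alpha%:M + invmx T *m W = invmx T *m (alpha *: T + W).
    by rewrite mulmxDr -scalemxAr mulVmx// scalemx1.
  by rewrite /B !mulmxA mulmxK// mulVmx.
have [NaU _] := mulmx1_unit NaB.
have axi0 i : alpha + xi i != 0.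
  (* Invertibility passes to the diagonal factor [D], so its determinant, the product of the alpha +
     xi_i, is nonzero. *)
  have : map_mx toC (alpha%:M + invmx T *m W) \in unitmx by rewrite map_unitmx.
  rewrite NaE !unitmx_mul => /andP[/andP[_ +] _].
  rewrite unitmxE unitfE det_diag => /prodf_neq0/(_ i isT).
  by rewrite mxE (inj_eq (@complexI R)).
split; first exact: axi0.
have BE : map_mx toC B =
    invmx P *m diag_mx (\row_i (toC (alpha + xi i))^-1) *m P.
  (* Both sides are right inverses of the same invertible matrix. *)
  apply: (can_inj (mulKmx (_ : map_mx toC (alpha%:M + invmx T *m W) \in _))).
    by rewrite map_unitmx.
  rewrite -map_mxM NaB map_mx1 NaE !mulmxA (mulmxK PU) -[_ *m D *m _]mulmxA.
  have -> : \row_i (toC (alpha + xi i))^-1 =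
      \row_i ((\row_i toC (alpha + xi i)) 0 i)^-1.
    by apply/rowP => i; rewrite !mxE.
  rewrite mulmx_diag_inv ?mulmx1 ?mulVmx// => i.
  by rewrite mxE (inj_eq (@complexI R)).
have GE : diag_mx (\row_i ((1 +i* alpha) * toC (xi i / (alpha + xi i)))) =
    (1 +i* alpha) *: (diag_mx (\row_i toC (xi i)) *m
                      diag_mx (\row_i (toC (alpha + xi i))^-1)).
  apply/matrixP => i j; rewrite mul_diag_mx !mxE.
  by rewrite !mulrnAr rmorphM fmorphV.
rewrite /plhss_matrix -mulmxA -/B map_mxM NE BE !mulmxA (mulmxK PU).
by rewrite GE -(scalemxAr _ (invmx P)) -(scalemxAl _ _ P) (mulmxA (invmx P)).
Qed.

(** The eigenvalues are exactly the [g i], so the supremum is a maximum; [i0] witnesses that the set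
    is nonempty. *)
Lemma spectral_radius_diag (G P : 'M[R[i]]_n) (g : 'I_n -> R[i]) (i0 : 'I_n) :
  P \in unitmx -> G = invmx P *m diag_mx (\row_i g i) *m P ->
  spectral_radius G = \big[Num.max/0]_i ComplexField.Normc.normc (g i).
Proof.
move=> PU GE.
have Geig l : reflect (exists i, l = g i) (eigenvalue G l).
  rewrite eigenvalue_root_char GE char_poly_similar// char_poly_diag.
  by under eq_bigr do rewrite mxE; exact: root_prodXsubC.
rewrite /spectral_radius; set E := [set _ | _ in _]%classic.
have Eg i : E (ComplexField.Normc.normc (g i)).
  by exists (g i) => //=; apply/Geig; exists i.
have Eub : ubound E (\big[Num.max/0]_i ComplexField.Normc.normc (g i)).
  by move=> _ [l /Geig[i ->] <-]; exact: le_bigmax.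
apply/le_anti/andP; split.
  by apply: ge_sup => //; exists (ComplexField.Normc.normc (g i0)).
have g_le i : ComplexField.Normc.normc (g i) <= sup E.
  by apply: ub_le_sup => //; eexists; exact: Eub.
(* The default 0 lies below the supremum because the modulus of [g i0] separates them. *)
apply: bigmax_le => [|i _]; last exact: g_le.
by apply: le_trans (g_le i0); case: (g i0) => a b /=; exact: sqrtr_ge0.
Qed.

End RealPencil.

(** * Scalar inequalities for the contraction factor *)

Section ContractionFactor.
Variable R : rcfType.
Implicit Types alpha x m : R.

(** Once the denominator is cleared and both sides squared, their difference factors as alpha (2 x -
    alpha (x^2 - 1)). *)
Lemma contraction_factor_lt1 alpha x : 0 < alpha -> alpha + x != 0 ->
  alpha * (x ^+ 2 - 1) < 2 * x ->
  Num.sqrt (1 + alpha ^+ 2) * (`|x| / `|alpha + x|) < 1.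
Proof.
move=> a0 ax0 hx; rewrite mulrA ltr_pdivrMr ?normr_gt0// mul1r.
rewrite -ltr_sqr ?nnegrE ?mulr_ge0 ?sqrtr_ge0// exprMn !real_normK ?num_real//.
rewrite sqr_sqrtr ?addr_ge0 ?sqr_ge0// -subr_gt0.
have -> : (alpha + x) ^+ 2 - (1 + alpha ^+ 2) * x ^+ 2 =
  alpha * (2 * x - alpha * (x ^+ 2 - 1)) by ring.
by rewrite mulr_gt0// subr_gt0.
Qed.

(** Here x^2 <= m^2, so alpha (x^2 - 1) <= alpha (m^2 - 1) < 2 m <= 2 x. *)
Lemma neg_contraction_condition alpha m x : 0 < alpha -> -1 < m -> m <= x ->
  x < 0 -> - 2 * m / (1 - m ^+ 2) < alpha -> alpha * (x ^+ 2 - 1) < 2 * x.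
Proof.
move=> a0 m1 mx x0; rewrite ltr_pdivrMr; last by nra.
move=> hm; have : alpha * x ^+ 2 <= alpha * m ^+ 2 by rewrite ler_pM2l//; nra.
by rewrite mulrBr mulr1 in hm *; lra.
Qed.

(** Since 0 < x <= 1, the left side is at most 0 and the right side is positive. *)
Lemma pos_contraction_condition_le1 alpha m x : 0 < alpha -> m <= 1 ->
  0 < x -> x <= m -> alpha * (x ^+ 2 - 1) < 2 * x.
Proof.
move=> a0 m1 x0 xm; apply: (@le_lt_trans _ _ 0); last by rewrite mulr_gt0.
by rewrite pmulr_rle0//; nra.
Qed.

(** Multiplying by m avoids dividing by x^2 - 1, whose sign is unknown: alpha (x^2 - 1) m <= alpha
    (m^2 - 1) x < 2 m x. *)
Lemma pos_contraction_condition alpha m x : 0 < alpha -> 1 < m ->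
  0 < x -> x <= m -> alpha < 2 * m / (m ^+ 2 - 1) ->
  alpha * (x ^+ 2 - 1) < 2 * x.
Proof.
move=> a0 m1 x0 xm; rewrite ltr_pdivlMr; last by nra.
move=> hm; have m0 : 0 < m by lra.
rewrite -(ltr_pM2r m0); apply: (@le_lt_trans _ _ (alpha * (m ^+ 2 - 1) * x)).
  rewrite -!mulrA ler_pM2l// -subr_ge0.
  have -> : (m ^+ 2 - 1) * x - (x ^+ 2 - 1) * m = (m - x) * (x * m + 1) by ring.
  by rewrite mulr_ge0 ?subr_ge0// addr_ge0// mulr_ge0// ltW.
by rewrite [ltRHS]mulrAC ltr_pM2r.
Qed.

End ContractionFactor.

(** * The formula for the spectral radius and the two parameter ranges *)

Lemma normc_scaled_real (R : realType) (alpha q : R) :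
  ComplexField.Normc.normc ((1 +i* alpha) * real_complex R q) =
  Num.sqrt (1 + alpha ^+ 2) * `|q|.
Proof.
rewrite ComplexField.Normc.normcM /= expr1n; congr (_ * _).
by rewrite expr0n addr0 sqrtr_sqr.
Qed.

Theorem theorem3p4 (R : realType) (n : nat) (W T : 'M[R]_n)
  (W_posdef : sym_posdef W) (T_indef : sym_indefinite T)
  (T_unit : T \in unitmx) :
  (exists xi : 'I_n -> R, is_real_spectrum (invmx T *m W) xi) /\
  forall xi : 'I_n -> R, is_real_spectrum (invmx T *m W) xi ->
  [/\ forall i, xi i != 0, exists i, xi i < 0 & exists i, 0 < xi i] /\
  forall alpha : R, 0 < alpha -> alpha *: T + W \in unitmx ->
  let rho := spectral_radius (plhss_matrix W T alpha) in
  let xm := xi_max_neg xi in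
  let xp := xi_max_pos xi in
  rho = Num.sqrt (1 + alpha ^+ 2) *
        \big[Num.max/0]_(i < n) (`|xi i| / `|alpha + xi i|) /\
  (-1 < xm < 0 ->
   (xp <= 1 -> - 2 * xm / (1 - xm ^+ 2) < alpha -> rho < 1) /\
   (1 < xp -> -1 < xm * xp ->
    - 2 * xm / (1 - xm ^+ 2) < alpha < 2 * xp / (xp ^+ 2 - 1) -> rho < 1)).
Proof.
have [P [xi0 [PU NE xi0_neq0 [i0 xi0_lt0] [j0 xi0_gt0]]]] :=
  pencil_diag W_posdef T_indef T_unit.
have spec0 := is_real_spectrum_diag PU NE.
split; first by exists xi0.
move=> xi spec; have xi_mem := real_spectrum_mem spec spec0.
have xi0_mem := real_spectrum_mem spec0 spec.
split.
  split=> [i||].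
  - by have [j ->] := xi_mem i.
  - by have [j xj] := xi0_mem i0; exists j; rewrite -xj.
  - by have [j xj] := xi0_mem j0; exists j; rewrite -xj.
move=> alpha alpha_gt0 AU rho xm xp.
have [a0_neq0 GE] := plhss_matrix_diag T_unit PU NE AU.
have a_neq0 i : alpha + xi i != 0 by have [j ->] := xi_mem i.
pose F x := Num.sqrt (1 + alpha ^+ 2) * (`|x| / `|alpha + x|).
have rhoE : rho = \big[Num.max/0]_(i < n) F (xi i).
  rewrite /rho (spectral_radius_diag i0 PU GE).
  under eq_bigr do rewrite normc_scaled_real normf_div -/(F _).
  (* [xi0] and [xi] take the same values, so each maximum bounds the other. *)
  apply/le_anti/andP; split.
    apply: bigmax_le => [|i _]; first exact: bigmax_ge_id.
    by have [j ->] := xi0_mem i; exact: (le_bigmax _ (fun k => F (xi k))).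
  apply: bigmax_le => [|i _]; first exact: bigmax_ge_id.
  by have [j ->] := xi_mem i; exact: (le_bigmax _ (fun k => F (xi0 k))).
split.
  rewrite rhoE.
  (* A nonnegative factor commutes with the maximum and fixes its default 0. *)
  rewrite (big_morph ( *%R (Num.sqrt (1 + alpha ^+ 2))) (id1 := 0)
    (op1 := Num.max)) ?mulr0//.
  by move=> x y; rewrite maxr_pMr// sqrtr_ge0.
have rho_lt1 : (forall i, alpha * (xi i ^+ 2 - 1) < 2 * xi i) -> rho < 1.
  move=> h; rewrite rhoE; apply: bigmax_lt => // i _.
  exact: contraction_factor_lt1.
move=> /andP[xm_gt xm_lt0].
have xi_neg i : - 2 * xm / (1 - xm ^+ 2) < alpha -> xi i < 0 ->
    alpha * (xi i ^+ 2 - 1) < 2 * xi i.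
  move=> ha xi_lt0; apply: (neg_contraction_condition _ xm_gt) => //.
  exact: bigmin_le_cond.
have xi_pos i : 0 < xi i -> xi i <= xp by move=> ?; exact: le_bigmax_cond.
have xi_neq0 i : xi i != 0 by have [j ->] := xi_mem i.
(* Negative eigenvalues are compared with [xm], positive ones with [xp]; zero is excluded. *)
split=> [xp_le1 ha|xp_gt1 _ /andP[ha ha']]; apply: rho_lt1 => i;
  have [/xi_neg|x_gt0|x_eq0] := ltgtP (xi i) 0; try exact.
- exact: pos_contraction_condition_le1 (xi_pos i _).
- by have := xi_neq0 i; rewrite x_eq0 eqxx.
- exact: pos_contraction_condition (xi_pos i _) _.
- by have := xi_neq0 i; rewrite x_eq0 eqxx.
Qed.
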